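(* Let $\phi,\xi: I\subset\mathbb{R}\to\mathbb{Q}_v$ be semi-real quaternionic curves with parameters $s^*$ and $s$, respectively. If $(\phi,\xi)$ are semi-real quaternionic involute-evolute curves, then the semi-real spatial quaternionic curves $(\beta,\alpha)$ in $\mathbb{R}_1^3$, associated with $\phi$ and $\xi$ respectively, are not semi-real spatial quaternionic involute-evolute curves.
   Context: $\mathbb{Q}_v$ denotes the space of semi-real quaternions $q=q_1\mathbf e_1+q_2\mathbf e_2+q_3\mathbf e_3+q_4$, identified with the semi-Euclidean space $\mathbb{E}_2^4$ with form $h(p,q)=p_1q_1+p_2q_2-p_3q_3-p_4q_4$ and norm $N(q)=\sqrt{|h(q,q)|}$. Spatial quaternions (those with $q+\overline q=0$, i.e. $q_4=0$) are identified with $\mathbb{R}_1^3$, with the inner product $h(p,q)=p_1q_1+p_2q_2-p_3q_3$. The products satisfy $\mathbf e_i\times\mathbf e_i=-\varepsilon_{e_i}$, and for $(ijk)$ an even permutation of $(123)$, $\mathbf e_i\times\mathbf e_j=\varepsilon_{e_i}\varepsilon_{e_j}\mathbf e_k$ in $\mathbb{R}_1^3$ and $\mathbf e_i\times\mathbf e_j=-\varepsilon_{e_i}\varepsilon_{e_j}\mathbf e_k$ in $\mathbb{R}_2^4$, with $\varepsilon_{e_i}\in\{\pm1\}$. For a unit speed curve $\xi$ in $\mathbb{Q}_v$ with Serret-Frenet frame $\{T,N,B,E\}$, the Serret-Frenet equations are $T'=\varepsilon_N\kappa N$, $N'=-\varepsilon_t\varepsilon_N\kappa T+\varepsilon_nkB$,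 $B'=-\varepsilon_tkN+\varepsilon_n(r-\varepsilon_t\varepsilon_T\varepsilon_N\kappa)E$, $E'=-\varepsilon_b(r-\varepsilon_t\varepsilon_T\varepsilon_N\kappa)B$, with $h(T,T)=\varepsilon_T$, $h(N,N)=\varepsilon_N$, $h(B,B)=\varepsilon_n\varepsilon_T$, $h(E,E)=\varepsilon_b\varepsilon_T$. The semi-real spatial quaternionic curve associated with $\xi$ is the curve $\alpha$ in $\mathbb{R}_1^3$ whose Frenet frame $\{t,n,b\}$ (with $h(t,t)=\varepsilon_t$, $h(n,n)=\varepsilon_n$, $h(b,b)=\varepsilon_b$, all $\pm1$) is determined by $N=\varepsilon_T(t\times T)$, $B=\varepsilon_T(n\times T)$, $E=\varepsilon_T(b\times T)$, and whose curvature and torsion are the $k$ and $r$ above. The associated curve of $\phi$ is $\beta$, with Frenet frame $\{t^*,n^*,b^*\}$. The curves $(\phi,\xi)$ are semi-real quaternionic involute-evolute curves ($\phi$ the involute) if $h(T_\phi(s^* ),T_\xi(s))=0$ at corresponding points, where $\phi(s^* )=\xi(s)+\lambda(s)T_\xi(s)$ for a smooth real function $\lambda$. Likewise $(\beta,\alpha)$ are semi-real spatial quaternionic involute-evolute curves if $h(t^*(s^* ),t(s))=0$ at corresponding points. The curves are assumed non-degenerate, so that all Frenet frames are defined and the curvatures do not vanish.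
   Formalization: The stated signs are contradictory (they force a frame of index 1 or 3 in E_2^4), so the spatial frame is normalised by h(t,t)=σε_t, h(n,n)=σε_n, h(b,b)=σε_b with an arbitrary common sign σ=±1; σ=1 is the stated convention and σ=−1 is the consistent one. *)

(* Defs.v *)
From HB Require Import structures.
From mathcomp Require Import all_boot all_order all_algebra.
From mathcomp Require Import all_classical all_reals all_analysis.

Set Implicit Arguments.
Unset Strict Implicit.
Unset Printing Implicit Defensive.

Import Order.TTheory GRing.Theory Num.Theory.
Import numFieldNormedType.Exports.

Local Open Scope classical_set_scope.
Local Open Scope ring_scope.

Section SemiRealQuaternions.
Variable R : realType.

Definition is_sign (x : R) : Prop := x = 1 \/ x = -1.

(* q = q_1 e_1 + q_2 e_2 + q_3 e_3 + q_4 has entries q_1, q_2, q_3, q_4 at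
   indices 0, 1, 2, 3; the unit of the algebra is at index 3. *)
Definition quat := 'rV[R]_4.

Definition spatial := 'rV[R]_3.

Definition mkquat (a b c d : R) : quat := \row_(i < 4) [:: a; b; c; d]`_i.

Definition quat_of (x : spatial) : quat := mkquat (x 0 0) (x 0 1) (x 0 2) 0.

(* The form of E_2^4. *)
Definition h4 (p q : quat) : R :=
  p 0 0 * q 0 0 + p 0 1 * q 0 1 - p 0 2 * q 0 2 - p 0 3 * q 0 3.

(* The form of R_1^3. *)
Definition h3 (x y : spatial) : R :=
  x 0 0 * y 0 0 + x 0 1 * y 0 1 - x 0 2 * y 0 2.

(* Bilinear extension of  e_i e_i = - eps_i  and, for (i j k) an even
   permutation of (1 2 3),  e_i e_j = - eps_i eps_j e_k = - e_j e_i.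
   For a general choice of the signs this product is not associative; it is
   for eps = (-1, -1, 1), in which case  q conj(q) = - h4 q q. *)
Definition qmul (eps : 'I_3 -> R) (p q : quat) : quat :=
  mkquat
    (p 0 3 * q 0 0 + p 0 0 * q 0 3
       - eps 1 * eps 2 * (p 0 1 * q 0 2 - p 0 2 * q 0 1))
    (p 0 3 * q 0 1 + p 0 1 * q 0 3
       - eps 2 * eps 0 * (p 0 2 * q 0 0 - p 0 0 * q 0 2))
    (p 0 3 * q 0 2 + p 0 2 * q 0 3
       - eps 0 * eps 1 * (p 0 0 * q 0 1 - p 0 1 * q 0 0))
    (p 0 3 * q 0 3 - eps 0 * p 0 0 * q 0 0
       - eps 1 * p 0 1 * q 0 1 - eps 2 * p 0 2 * q 0 2).

(* A curve of R_1^3 with its Frenet apparatus: frame, curvature, torsion and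
   signs. *)
Record spatial_curve := SpatialCurve {
  spos : R -> spatial;
  st : R -> spatial; sn : R -> spatial; sb : R -> spatial;
  sk : R -> R; sr : R -> R;
  epst : R; epsn : R; epsb : R }.

(* A curve of E_2^4 with its Serret-Frenet frame, principal curvature, and the
   signs of T and N. Its other two curvatures involve the curvature and
   torsion of the associated spatial curve. *)
Record quat_curve := QuatCurve {
  qpos : R -> quat;
  qT : R -> quat; qN : R -> quat; qB : R -> quat; qE : R -> quat;
  qkappa : R -> R;
  epsT : R; epsN : R }.

(* [c] is a unit speed curve on [I] with Frenet frame {t, n, b}.
   About [sg]: the usual convention  h(t,t) = eps_t, h(n,n) = eps_n,
   h(b,b) = eps_b  is sg = 1. The Serret-Frenet formulas of [quat_frenet]
   rest on the rule  t t = - eps_t  (and likewise for n and b). When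
   q conj(q) = - h4 q q,  spatial x satisfy  x x = h3 x x,  so that the rule
   reads h(t,t) = - eps_t, which is sg = -1. (With sg = 1, orthogonality of T and N
   gives eps_N = eps_t eps_T, so that {T, N, B, E} has signs
   eps_T (1, eps_t, eps_n, eps_b); exactly one of eps_t, eps_n, eps_b is then
   negative, which is impossible for the index-2 form h4.) Both conventions
   are admitted. *)
Definition spatial_frenet (sg : R) (I : set R) (c : spatial_curve) : Prop :=
  [/\ is_sign (epst c), is_sign (epsn c) & is_sign (epsb c)] /\
  forall s : R, I s ->
  [/\ [/\ h3 (st c s) (st c s) = sg * epst c,
          h3 (sn c s) (sn c s) = sg * epsn c &
          h3 (sb c s) (sb c s) = sg * epsb c],
      [/\ h3 (st c s) (sn c s) = 0,
          h3 (st c s) (sb c s) = 0 &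
          h3 (sn c s) (sb c s) = 0],
      is_derive s 1 (spos c) (st c s) &
      [/\ is_derive s 1 (st c) ((epsn c * sk c s) *: sn c s),
          is_derive s 1 (sn c)
            (- (epst c * sk c s) *: st c s + (epsn c * sr c s) *: sb c s) &
          is_derive s 1 (sb c) (- (epsb c * sr c s) *: sn c s)]].

(* Third curvature  r - eps_t eps_T eps_N kappa. *)
Definition bitorsion (xi : quat_curve) (al : spatial_curve) (s : R) : R :=
  sr al s - epst al * epsT xi * epsN xi * qkappa xi s.

(* [xi] is a unit speed curve on [I] with Serret-Frenet frame {T, N, B, E}. *)
Definition quat_frenet (I : set R) (xi : quat_curve) (al : spatial_curve)
    : Prop :=
  (is_sign (epsT xi) /\ is_sign (epsN xi)) /\
  forall s : R, I s ->
  [/\ [/\ h4 (qT xi s) (qT xi s) = epsT xi,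
          h4 (qN xi s) (qN xi s) = epsN xi,
          h4 (qB xi s) (qB xi s) = epsn al * epsT xi &
          h4 (qE xi s) (qE xi s) = epsb al * epsT xi],
      [/\ h4 (qT xi s) (qN xi s) = 0,
          h4 (qT xi s) (qB xi s) = 0 &
          h4 (qT xi s) (qE xi s) = 0] /\
      [/\ h4 (qN xi s) (qB xi s) = 0,
          h4 (qN xi s) (qE xi s) = 0 &
          h4 (qB xi s) (qE xi s) = 0],
      is_derive s 1 (qpos xi) (qT xi s) &
      [/\ is_derive s 1 (qT xi) ((epsN xi * qkappa xi s) *: qN xi s),
          is_derive s 1 (qN xi)
            (- (epst al * epsN xi * qkappa xi s) *: qT xi s
             + (epsn al * sk al s) *: qB xi s),
          is_derive s 1 (qB xi)
            (- (epst al * sk al s) *: qN xi s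
             + (epsn al * bitorsion xi al s) *: qE xi s) &
          is_derive s 1 (qE xi) (- (epsb al * bitorsion xi al s) *: qB xi s)]].

(* [al] is the spatial quaternionic curve associated with [xi], both
   parametrized by the parameter of [xi], and both being non-degenerate. *)
Definition associated (eps : 'I_3 -> R) (sg : R) (I : set R)
    (xi : quat_curve) (al : spatial_curve) : Prop :=
  [/\ quat_frenet I xi al,
      spatial_frenet sg I al,
      forall s : R, I s ->
        [/\ qN xi s = epsT xi *: qmul eps (quat_of (st al s)) (qT xi s),
            qB xi s = epsT xi *: qmul eps (quat_of (sn al s)) (qT xi s) &
            qE xi s = epsT xi *: qmul eps (quat_of (sb al s)) (qT xi s)] &
      forall s : R, I s ->
        [/\ qkappa xi s != 0, sk al s != 0, sr al s != 0 &
            bitorsion xi al s != 0]].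

Definition open_interval (I : set R) : Prop :=
  [/\ open I, is_interval I & I !=set0].

Definition smooth_on (I : set R) (f : R -> R) : Prop :=
  forall (n : nat) (s : R), I s -> derivable (derive1n n f) s 1.

(* The points of parameters s and s^* = sstar s correspond to each other. *)
Definition correspondence (I J : set R) (sstar : R -> R) : Prop :=
  smooth_on I sstar /\ forall s : R, I s -> J (sstar s).

Definition involute_evolute (I : set R) (sstar : R -> R)
    (phi xi : quat_curve) : Prop :=
  exists lambda : R -> R, smooth_on I lambda /\
    forall s : R, I s ->
      qpos phi (sstar s) = qpos xi s + lambda s *: qT xi s /\
      h4 (qT phi (sstar s)) (qT xi s) = 0.

Definition spatial_involute_evolute (I : set R) (sstar : R -> R)
    (be al : spatial_curve) : Prop :=
  forall s : R, I s -> h3 (st be (sstar s)) (st al s) = 0.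

End SemiRealQuaternions.

(* Main.v *)
Require Import Defs.
From mathcomp Require Import all_boot all_order all_algebra.
From mathcomp Require Import all_classical all_reals all_analysis.
From mathcomp Require Import ring lra.

Set Implicit Arguments.
Unset Strict Implicit.
Unset Printing Implicit Defensive.

Import Order.TTheory GRing.Theory Num.Theory.
Import numFieldNormedType.Exports.

Local Open Scope classical_set_scope.
Local Open Scope ring_scope.

(* Differentiating phi(s^* ) = xi + lambda T_xi and pairing with T_xi gives
   lambda' = -1 and  s^*' T_phi = lambda eps_N kappa N_xi; pick s with
   lambda(s) <> 0. There h(T_phi, N_xi) <> 0, so differentiating
   h(T_phi, T_xi) = 0 gives h(N_phi, T_xi) <> 0. On the other hand N_phi is a
   multiple of t^* T_phi, hence of t^* (t T_xi), and for the associative product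
   h(t^* (t T), T) = h(t^*, t) h(T, T), so that h(t^*, t) <> 0.

   The other choices of the signs eps cannot occur. As T is orthogonal to
   N, B, E, one has h(x T, T) = 0 for every spatial x, that is, three
   quadratic equations for T. Since T lies in no hyperplane on any open
   interval, at some parameter T avoids finitely many given hyperplanes, and
   then these equations force eps = (-1, -1, 1). *)

(** For the matrix M with rows [v i], the Gram matrix M G M^T is diagonal with nonzero entries.
    Hence M is invertible, and M w = 0 leaves only w = 0. *)
Lemma orthogonal_frame_separating (F : fieldType) (n : nat) (G : 'M[F]_n)
    (v : 'I_n -> 'rV[F]_n) (d : 'I_n -> F) (w : 'cV[F]_n) :
  (forall i j, (v i *m G *m (v j)^T) 0 0 = if i == j then d i else 0) ->
  (forall i, d i != 0) -> (forall i, (v i *m w) 0 0 = 0) -> w = 0.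
Proof.
move=> vG d0 vw.
pose M := \matrix_i v i.
have Mw : M *m w = 0.
  apply/matrixP => i j; rewrite ord1 [RHS]mxE -(vw i) !mxE.
  by apply: eq_bigr => k _; rewrite mxE.
have MGM : M *m (G *m M^T) = diag_mx (\row_i d i).
  apply/matrixP => i j; have -> : diag_mx (\row_i d i) i j = (v i *m G *m (v j)^T) 0 0.
    by rewrite vG !mxE mulrb.
  rewrite mulmxA !mxE.
  apply: eq_bigr => k _; rewrite !mxE; congr (_ * _).
  by apply: eq_bigr => l _; rewrite mxE.
have Du : diag_mx (\row_i d i) \in unitmx.
  rewrite unitmxE det_diag unitfE; apply/prodf_neq0 => i _.
  by rewrite mxE.
have /mulmx1C MM : M *m (G *m M^T *m invmx (diag_mx (\row_i d i))) = 1%:M.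
  by rewrite mulmxA MGM mulmxV.
by rewrite -[w]mul1mx -MM -(mulmxA _ M w) Mw mulmx0.
Qed.

(** * The forms and the product in coordinates *)

Section Coordinates.
Variable R : realType.

Lemma mkquatE (a b c d : R) :
  [/\ mkquat a b c d 0 0 = a, mkquat a b c d 0 1 = b,
      mkquat a b c d 0 2 = c & mkquat a b c d 0 3 = d].
Proof. by rewrite /mkquat; split; rewrite mxE. Qed.

Lemma h4E (p q : quat R) :
  h4 p q = (p *m diag_mx (\row_i [:: 1; 1; -1; -1]`_i) *m q^T) 0 0.
Proof.
rewrite mul_mx_diag mxE !big_ord_recl big_ord0 /h4 !mxE /=.
have -> : lift (0 : 'I_4) 0 = 1 by apply/val_inj.
have -> : lift (0 : 'I_4) (lift 0 0) = 2 by apply/val_inj.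
have -> : lift (0 : 'I_4) (lift 0 (lift 0 0)) = 3 by apply/val_inj.
ring.
Qed.

Lemma h3E (p q : spatial R) :
  h3 p q = (p *m diag_mx (\row_i [:: 1; 1; -1]`_i) *m q^T) 0 0.
Proof.
rewrite mul_mx_diag mxE !big_ord_recl big_ord0 /h3 !mxE /=.
have -> : lift (0 : 'I_3) 0 = 1 by apply/val_inj.
have -> : lift (0 : 'I_3) (lift 0 0) = 2 by apply/val_inj.
ring.
Qed.

Lemma h4C (p q : quat R) : h4 p q = h4 q p.
Proof. by rewrite /h4; ring. Qed.

Lemma h4Zl (a : R) (p q : quat R) : h4 (a *: p) q = a * h4 p q.
Proof. by rewrite /h4 !mxE; ring. Qed.

Lemma h4Dl (p q r : quat R) : h4 (p + q) r = h4 p r + h4 q r.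
Proof. by rewrite /h4 !mxE; ring. Qed.

Lemma h3C (p q : spatial R) : h3 p q = h3 q p.
Proof. by rewrite /h3; ring. Qed.

Lemma qmulZr (eps : 'I_3 -> R) (a : R) (p q : quat R) :
  qmul eps p (a *: q) = a *: qmul eps p q.
Proof.
apply/rowP => i; rewrite /qmul /mkquat !mxE.
by case: i => -[|[|[|[|//]]]] ? /=; ring.
Qed.

Lemma is_sign_neq0 (x : R) : is_sign x -> x != 0.
Proof. by case=> ->; rewrite ?oppr_eq0 oner_eq0. Qed.

End Coordinates.

(** * Differentiation of vector-valued curves *)

Section Derivatives.
Variable R : realType.

Lemma is_derive_unique (V : normedModType R) (f : R -> V) (s : R) (a b : V) :
  is_derive s 1 f a -> is_derive s 1 f b -> a = b.
Proof. by move=> [_ <-] [_ <-]. Qed.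

Lemma is_derive_coord m n (f : R -> 'M[R]_(m, n)) (s : R) (df : 'M[R]_(m, n)) i j :
  is_derive s 1 f df -> is_derive s 1 (fun x => f x i j) (df i j).
Proof.
move=> [f' <-]; split; first exact: (derivable_mxP f s 1).1.
by rewrite derive_mx// mxE.
Qed.

Lemma is_derive_mx m n (f : R -> 'M[R]_(m, n)) (s : R) (df : 'M[R]_(m, n)) :
  (forall i j, is_derive s 1 (fun x => f x i j) (df i j)) -> is_derive s 1 f df.
Proof.
move=> f'.
have fd : derivable f s 1 by apply/derivable_mxP => i j; case: (f' i j).
split=> //; rewrite derive_mx//; apply/matrixP => i j; rewrite mxE.
by case: (f' i j).
Qed.

Lemma is_derive_zero_on (V : normedModType R) (U : set R) (f : R -> V)
    (s : R) (df : V) :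
  open U -> U s -> (forall x, U x -> f x = 0) -> is_derive s 1 f df -> df = 0.
Proof.
move=> oU Us f0 f'.
apply: is_derive_unique f' _.
apply: (near_eq_is_derive (f := cst 0)).
apply: filterS (open_nbhs_nbhs (conj oU Us)) => x Ux.
by rewrite f0.
Qed.

(** A column [w] encodes a linear form on rows, and its kernel a hyperplane; this serves to follow a
    linear form along a moving frame. *)
Lemma is_derive_functional n (f : R -> 'rV[R]_n) (s : R) (df : 'rV[R]_n) (w : 'cV[R]_n) :
  is_derive s 1 f df ->
  is_derive s 1 (fun x => (f x *m w) 0 0) ((df *m w) 0 0).
Proof.
move=> f'.
have -> : (fun x => (f x *m w) 0 0) = \sum_i (w i 0 *: (fun x => f x 0 i)).
  apply/funext => x; rewrite mxE fct_sumE; apply: eq_bigr => i _.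
  by rewrite mulrC.
rewrite mxE (eq_bigr (fun i => w i 0 *: df 0 i)); last first.
  by move=> i _; rewrite mulrC.
apply: is_derive_sum => i.
apply: is_deriveZ; exact: is_derive_coord.
Qed.

Lemma is_derive_h4 (f g : R -> quat R) (s : R) df dg :
  is_derive s 1 f df -> is_derive s 1 g dg ->
  is_derive s 1 (fun x => h4 (f x) (g x)) (h4 df (g s) + h4 (f s) dg).
Proof.
move=> f' g'.
have fi := is_derive_coord 0 _ f'.
have gi := is_derive_coord 0 _ g'.
pose F i := (fun x => f x 0 i) * (fun x => g x 0 i).
(* In terms of ring operations on functions, the derivative is found by instance resolution from
   [fi] and [gi]. *)
have -> : (fun x => h4 (f x) (g x)) = F 0 + F 1 - F 2 - F 3 by [].
rewrite /F.
apply: is_derive_eq.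
rewrite /h4 /= /GRing.scale /=; ring.
Qed.

Lemma is_derive_reparam m n (f : R -> 'M[R]_(m, n)) (g : R -> R) (s : R) df :
  derivable g s 1 -> is_derive (g s) 1 f df ->
  is_derive s 1 (fun x => f (g x)) (g^`()%classic s *: df).
Proof.
move=> g' f'; apply: is_derive_mx => i j.
have fij := is_derive_coord i j f'.
rewrite mxE mulrC derive1E.
exact: is_derive1_comp fij (derivableP g').
Qed.

End Derivatives.

(** * Frames as bases, and the tangent avoiding hyperplanes *)

Section Associated.
Context {R : realType} {eps : 'I_3 -> R} {sg : R} {I : set R}.
Context {xi : quat_curve R} {al : spatial_curve R}.
Hypothesis xial : associated eps sg I xi al.

Lemma quat_frame_separating (s : R) (w : 'cV[R]_4) : I s ->
  (qT xi s *m w) 0 0 = 0 -> (qN xi s *m w) 0 0 = 0 ->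
  (qB xi s *m w) 0 0 = 0 -> (qE xi s *m w) 0 0 = 0 -> w = 0.
Proof.
move=> Is Tw Nw Bw Ew.
have [[[sT sN] fr] [[st sn sb] _] _ _] := xial.
have [[TT NN BB EE] [[TN TB TE] [NB NE BE]] _ _] := fr s Is.
pose v (i : 'I_4) := [:: qT xi s; qN xi s; qB xi s; qE xi s]`_i.
pose d (i : 'I_4) := [:: epsT xi; epsN xi; epsn al * epsT xi; epsb al * epsT xi]`_i.
apply: (orthogonal_frame_separating (n := 4) (d := d) (v := v)
  (G := diag_mx (\row_i [:: 1; 1; -1; -1]`_i))) => [i j|i|i].
- rewrite -h4E -val_eqE /v /d.
  by case: i j => [[|[|[|[|//]]]] ?] [[|[|[|[|//]]]] ?] //=; rewrite h4C.
- by case: i => [[|[|[|[|//]]]] ?]; rewrite /d /= ?mulf_neq0 //; exact: is_sign_neq0.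
- by case: i => [[|[|[|[|//]]]] ?].
Qed.

Lemma spatial_frame_separating (s : R) (w : 'cV[R]_3) : is_sign sg -> I s ->
  (st al s *m w) 0 0 = 0 -> (sn al s *m w) 0 0 = 0 ->
  (sb al s *m w) 0 0 = 0 -> w = 0.
Proof.
move=> ssg Is tw nw bw.
have [_ [[st sn sb] fr] _ _] := xial.
have [[tt nn bb] [tn tb nb] _ _] := fr s Is.
pose v (i : 'I_3) := [:: Defs.st al s; Defs.sn al s; Defs.sb al s]`_i.
pose d (i : 'I_3) := [:: sg * epst al; sg * epsn al; sg * epsb al]`_i.
apply: (orthogonal_frame_separating (n := 3) (d := d) (v := v)
  (G := diag_mx (\row_i [:: 1; 1; -1]`_i))) => [i j|i|i].
- rewrite -h3E -val_eqE /v /d.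
  by case: i j => [[|[|[|//]]] ?] [[|[|[|//]]] ?] //=; rewrite h3C.
- by case: i => [[|[|[|//]]] ?]; rewrite /d /= ?mulf_neq0 //; exact: is_sign_neq0.
- by case: i => [[|[|[|//]]] ?].
Qed.

(* Differentiating T.w = 0 with the Serret-Frenet equations yields N.w = B.w =
   E.w = 0, since the curvatures do not vanish. *)
Lemma tangent_in_no_hyperplane (U : set R) (w : 'cV[R]_4) :
  open U -> U !=set0 -> U `<=` I ->
  (forall x, U x -> (qT xi x *m w) 0 0 = 0) -> w = 0.
Proof.
move=> oU [s Us] UI Tw.
have [[[sT sN] fr] [[st sn sb] _] _ nz] := xial.
have Nw x : U x -> (qN xi x *m w) 0 0 = 0.
  move=> Ux; have [_ _ _ [T' _ _ _]] := fr x (UI _ Ux).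
  have := is_derive_zero_on oU Ux Tw (is_derive_functional w T').
  rewrite -scalemxAl mxE => /eqP; have [k0 _ _ _] := nz x (UI _ Ux).
  by rewrite !mulf_eq0 (negbTE k0) (negbTE (is_sign_neq0 sN)) => /eqP.
have Bw x : U x -> (qB xi x *m w) 0 0 = 0.
  move=> Ux; have [_ _ _ [_ N' _ _]] := fr x (UI _ Ux).
  have := is_derive_zero_on oU Ux Nw (is_derive_functional w N').
  rewrite mulmxDl -!scalemxAl mxE [X in X + _]mxE Tw// mulr0 add0r mxE => /eqP.
  have [_ k0 _ _] := nz x (UI _ Ux).
  by rewrite !mulf_eq0 (negbTE k0) (negbTE (is_sign_neq0 sn)) => /eqP.
have Ew x : U x -> (qE xi x *m w) 0 0 = 0.
  move=> Ux; have [_ _ _ [_ _ B' _]] := fr x (UI _ Ux).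
  have := is_derive_zero_on oU Ux Bw (is_derive_functional w B').
  rewrite mulmxDl -!scalemxAl mxE [X in X + _]mxE Nw// mulr0 add0r mxE => /eqP.
  have [_ _ _ k0] := nz x (UI _ Ux).
  by rewrite !mulf_eq0 (negbTE k0) (negbTE (is_sign_neq0 sn)) => /eqP.
apply: (quat_frame_separating (UI _ Us)); auto.
Qed.

(** Some point of U has T off the hyperplane, and continuity of T spreads this to a neighbourhood.
    The open set V makes the argument repeatable. *)
Lemma tangent_off_hyperplane (U : set R) (w : 'cV[R]_4) : w != 0 ->
  open U -> U !=set0 -> U `<=` I ->
  exists V : set R, [/\ open V, V !=set0, V `<=` U &
    forall x, V x -> (qT xi x *m w) 0 0 != 0].
Proof.
move=> w0 oU U0 UI.
have [s [Us Tw]] : exists s, U s /\ (qT xi s *m w) 0 0 != 0.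
  apply: contrapT => /forallNP nT; move/eqP: w0; apply.
  apply: (tangent_in_no_hyperplane (U := U)) => // x Ux.
  by apply/eqP/negPn/negP => Tx; apply: (nT x).
have [[_ fr] _ _ _] := xial.
have [_ _ _ [T' _ _ _]] := fr s (UI _ Us).
have /= [dT _] := is_derive_functional w T'.
have cT := differentiable_continuous ((derivable1_diffP _ _).1 dT).
have : nbhs s [set x | U x /\ (qT xi x *m w) 0 0 != 0].
  apply: filterI; first exact: open_nbhs_nbhs.
  exact: (cvgr_neq0 _ cT).
rewrite nbhsE => -[V [oV Vs] VP].
by exists V; split=> //; [exists s| move=> x /VP[]|move=> x /VP[]].
Qed.

Lemma tangent_off_hyperplanes (ws : seq 'cV[R]_4) :
  open I -> I !=set0 -> all (fun w => w != 0) ws ->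
  exists s, I s /\ all (fun w => (qT xi s *m w) 0 0 != 0) ws.
Proof.
move=> oI I0.
(* The induction on [ws] is over all open U, since each hyperplane shrinks the set of admissible
   parameters. *)
suff H U : open U -> U !=set0 -> U `<=` I -> all (fun w => w != 0) ws ->
    exists s, U s /\ all (fun w => (qT xi s *m w) 0 0 != 0) ws.
  exact: H.
elim: ws U => [|w ws IH] U oU U0 UI /=; first by case: U0 => s; exists s.
move=> /andP[w0 ws0].
have [V [oV V0 VU VT]] := tangent_off_hyperplane w0 oU U0 UI.
have [s [Vs sP]] := IH _ oV V0 (subset_trans VU UI) ws0.
by exists s; rewrite sP VT//; split=> //; exact: VU.
Qed.

End Associated.

(** * Which signs are compatible with a generic tangent *)

Section Signs.
Context {R : realType}.

Lemma qmulE (eps : 'I_3 -> R) (x : spatial R) (p : quat R) :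
  [/\ qmul eps (quat_of x) p 0 0 =
        x 0 0 * p 0 3 - eps 1 * eps 2 * (x 0 1 * p 0 2 - x 0 2 * p 0 1),
      qmul eps (quat_of x) p 0 1 =
        x 0 1 * p 0 3 - eps 2 * eps 0 * (x 0 2 * p 0 0 - x 0 0 * p 0 2),
      qmul eps (quat_of x) p 0 2 =
        x 0 2 * p 0 3 - eps 0 * eps 1 * (x 0 0 * p 0 1 - x 0 1 * p 0 0) &
      qmul eps (quat_of x) p 0 3 =
        - eps 0 * x 0 0 * p 0 0 - eps 1 * x 0 1 * p 0 1
          - eps 2 * x 0 2 * p 0 2].
Proof.
rewrite /qmul.
case: (mkquatE (x 0 0) (x 0 1) (x 0 2) (0 : R)); rewrite -/(quat_of x).
move=> x0 x1 x2 x3.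
case: (mkquatE
    (quat_of x 0 3 * p 0 0 + quat_of x 0 0 * p 0 3
       - eps 1 * eps 2 * (quat_of x 0 1 * p 0 2 - quat_of x 0 2 * p 0 1))
    (quat_of x 0 3 * p 0 1 + quat_of x 0 1 * p 0 3
       - eps 2 * eps 0 * (quat_of x 0 2 * p 0 0 - quat_of x 0 0 * p 0 2))
    (quat_of x 0 3 * p 0 2 + quat_of x 0 2 * p 0 3
       - eps 0 * eps 1 * (quat_of x 0 0 * p 0 1 - quat_of x 0 1 * p 0 0))
    (quat_of x 0 3 * p 0 3 - eps 0 * quat_of x 0 0 * p 0 0
       - eps 1 * quat_of x 0 1 * p 0 1 - eps 2 * quat_of x 0 2 * p 0 2)).
by move=> -> -> -> ->; rewrite x0 x1 x2 x3; split; ring.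
Qed.

(** The coefficients of the linear form x |-> h(x p, p) on spatial x. For signs eps they vanish
    identically in p only when eps = (-1, -1, 1). *)
Definition qmul_defect (eps : 'I_3 -> R) (p : quat R) : 'cV[R]_3 :=
  \col_i [:: (1 + eps 0) * (p 0 0 * p 0 3)
               + eps 0 * (eps 1 + eps 2) * (p 0 1 * p 0 2);
             (1 + eps 1) * (p 0 1 * p 0 3)
               - eps 1 * (eps 0 + eps 2) * (p 0 0 * p 0 2);
             (eps 2 - 1) * (p 0 2 * p 0 3)
               + eps 2 * (eps 1 - eps 0) * (p 0 0 * p 0 1)]`_i.

Lemma h4_qmul (eps : 'I_3 -> R) (x : spatial R) (p : quat R) :
  h4 (qmul eps (quat_of x) p) p = (x *m qmul_defect eps p) 0 0.
Proof.
rewrite /h4; case: (qmulE eps x p) => -> -> -> ->.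
rewrite mxE !big_ord_recl big_ord0 !mxE /=.
have -> : lift (0 : 'I_3) 0 = 1 by apply/val_inj.
have -> : lift (0 : 'I_3) (lift 0 0) = 2 by apply/val_inj.
ring.
Qed.

(** In each of the seven other sign patterns, a combination of the three equations equates to 0 a
    product of factors that the hypotheses keep nonzero. *)
Lemma signs_of_generic_tangent (eps : 'I_3 -> R) (p : quat R) :
  (forall i, is_sign (eps i)) -> qmul_defect eps p = 0 ->
  p 0 0 != 0 -> p 0 1 != 0 -> p 0 2 != 0 -> p 0 3 != 0 ->
  p 0 0 - p 0 2 != 0 -> p 0 0 + p 0 2 != 0 ->
  p 0 1 - p 0 2 != 0 -> p 0 1 + p 0 2 != 0 ->
  [/\ eps 0 = -1, eps 1 = -1 & eps 2 = 1].
Proof.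
move=> heps D0.
have := congr1 (fun u : 'cV_3 => u 0 0) D0.
have := congr1 (fun u : 'cV_3 => u 1 0) D0.
have := congr1 (fun u : 'cV_3 => u 2 0) D0.
rewrite !mxE /=.
move: (p 0 0) (p 0 1) (p 0 2) (p 0 3) => a b c d A3 A2 A1 a0 b0 c0 d0 ac ac' bc bc'.
(* Each excluded pattern is closed by exhibiting a nonzero x that equals 0. *)
have nz (x : R) : x != 0 -> x = 0 -> [/\ eps 0 = -1, eps 1 = -1 & eps 2 = 1].
  by move=> /eqP.
have e0 := heps 0; have e1 := heps 1; have e2 := heps 2.
case: e0 => E0; case: e1 => E1; case: e2 => E2; rewrite E0 E1 E2 in A1 A2 A3 nz *.
(* eps = (1, 1, 1): eliminating the abc terms leaves d (a^2 + b^2). *)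
- have B1 : a * d + b * c = 0 by lra.
  have B2 : b * d - a * c = 0 by lra.
  apply: (nz (d * (a ^+ 2 + b ^+ 2))).
    rewrite mulf_neq0// paddr_eq0 ?sqr_ge0// !sqrf_eq0.
    by rewrite (negbTE a0).
  transitivity (a * (a * d + b * c) + b * (b * d - a * c)); first by ring.
  by rewrite B1 B2; ring.
- by apply: (nz (a * d)); [rewrite mulf_neq0 | lra].
- by apply: (nz (a * d)); [rewrite mulf_neq0 | lra].
(* eps = (1, -1, -1): the same elimination leaves d (a^2 - c^2), whence the hyperplanes a = c and a
   = -c. The pattern (-1, 1, -1) gives b = c and b = -c likewise. *)
- have B1 : a * d - b * c = 0 by lra.
  have B3 : a * b - c * d = 0 by lra.
  apply: (nz (d * ((a - c) * (a + c)))); first by rewrite !mulf_neq0.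
  transitivity (a * (a * d - b * c) + c * (a * b - c * d)); first by ring.
  by rewrite B1 B3; ring.
- by apply: (nz (b * c)); [rewrite mulf_neq0 | lra].
- have B2 : b * d + a * c = 0 by lra.
  have B3 : a * b + c * d = 0 by lra.
  apply: (nz (d * ((b - c) * (b + c)))); first by rewrite !mulf_neq0.
  transitivity (b * (b * d + a * c) - c * (a * b + c * d)); first by ring.
  by rewrite B2 B3; ring.
- by [].
- by apply: (nz (b * c)); [rewrite mulf_neq0 | lra].
Qed.

(** For these signs x (y p) = (x y) p, and x y has scalar part h(x, y). Its spatial part u
    contributes h(u p, p) = 0. *)
Lemma h4_qmul_qmul (eps : 'I_3 -> R) (x y : spatial R) (p : quat R) :
  eps 0 = -1 -> eps 1 = -1 -> eps 2 = 1 ->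
  h4 (qmul eps (quat_of x) (qmul eps (quat_of y) p)) p = h3 x y * h4 p p.
Proof.
move=> e0 e1 e2; rewrite {1}/h4.
case: (qmulE eps x (qmul eps (quat_of y) p)) => -> -> -> ->.
case: (qmulE eps y p) => -> -> -> ->.
by rewrite e0 e1 e2 /h3 /h4; ring.
Qed.

End Signs.

(** * Determination of the signs eps *)

Section SignsOfAssociated.
Context {R : realType} {eps : 'I_3 -> R} {sg : R} {I : set R}.
Context {xi : quat_curve R} {al : spatial_curve R}.
Hypothesis xial : associated eps sg I xi al.

(** Up to the factor eps_T, the defect pairs with t, n, b to h(N, T), h(B, T), h(E, T), which are
    all 0, and {t, n, b} is a basis. *)
Lemma qmul_defect_tangent (s : R) : is_sign sg -> I s ->
  qmul_defect eps (qT xi s) = 0.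
Proof.
move=> hsg Is.
have [[[sT _] fr] _ NBE _] := xial.
have [_ [[TN TB TE] _] _ _] := fr s Is.
have [N B E] := NBE s Is.
apply: (spatial_frame_separating xial hsg Is); rewrite -h4_qmul;
  apply: (mulfI (is_sign_neq0 sT)); rewrite mulr0 -h4Zl h4C -?N -?B -?E //.
Qed.

Lemma associated_signs : (forall i, is_sign (eps i)) -> is_sign sg ->
  open I -> I !=set0 -> [/\ eps 0 = -1, eps 1 = -1 & eps 2 = 1].
Proof.
move=> heps hsg oI I0.
pose e (i : 'I_4) : 'cV[R]_4 := delta_mx i 0.
have eE (p : quat R) i j (a : R) :
    (p *m (e i + a *: e j)) 0 0 = p 0 i + a * p 0 j.
  by rewrite mulmxDr -scalemxAr -!colE !mxE.
have e0 (i j : 'I_4) (a : R) : i != j -> e i + a *: e j != 0.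
  move=> ij; apply/eqP => /(congr1 (fun u : 'cV_4 => u i 0)).
  rewrite !mxE !eqxx (negbTE ij) /= mulr0 addr0 => /eqP; apply/negP.
  exact: oner_neq0.
(* These are the eight linear forms required by [signs_of_generic_tangent]. The zero terms give all
   of them the shape handled by [eE] and [e0]. *)
pose ws := [:: e 0 + 0 *: e 1; e 1 + 0 *: e 0; e 2 + 0 *: e 0; e 3 + 0 *: e 0;
  e 0 + (-1) *: e 2; e 0 + 1 *: e 2; e 1 + (-1) *: e 2; e 1 + 1 *: e 2].
have ws0 : all (fun w => w != 0) ws by rewrite /ws /= !e0.
have [s [Is]] := tangent_off_hyperplanes xial oI I0 ws0.
rewrite /ws /= !eE !mul0r !addr0 !mulN1r !mul1r.
move=> /and5P[p0 p1 p2 p3 /and5P[m02 a02 m12 a12 _]].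
exact: (signs_of_generic_tangent heps (qmul_defect_tangent hsg Is)).
Qed.

End SignsOfAssociated.

(** * Tangent and principal normal of an involute *)

Section Involute.
Context {R : realType} {eps : 'I_3 -> R} {sg : R} {I J : set R}.
Context {phi xi : quat_curve R} {beta alpha : spatial_curve R} {sstar : R -> R}.
Hypotheses (oI : open I) (I0 : I !=set0).
Hypotheses (hxi : associated eps sg I xi alpha)
  (hphi : associated eps sg J phi beta) (hstar : correspondence I J sstar).
Hypothesis invol : involute_evolute I sstar phi xi.

Local Notation dsstar := (sstar^`())%classic.

Lemma involute_tangent : exists s (mu : R),
  [/\ I s, mu != 0 & dsstar s *: qT phi (sstar s) = mu *: qN xi s].
Proof.
have [lambda [slambda inv]] := invol.
have [sstar_smooth IJ] := hstar.
have [[[sT sN] fr] _ _ nz] := hxi.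
have [[_ frphi] _ _ _] := hphi.
have lambda' s : I s -> is_derive s 1 lambda (lambda^`()%classic s).
  by move=> Is; rewrite derive1E; exact: derivableP (slambda 0%N s Is).
have velocity s : I s -> dsstar s *: qT phi (sstar s) =
    (1 + lambda^`()%classic s) *: qT xi s
      + (lambda s * (epsN xi * qkappa xi s)) *: qN xi s.
  move=> Is.
  have [_ _ qphi' _] := frphi _ (IJ _ Is).
  have [_ _ qxi' [T' _ _ _]] := fr _ Is.
  have dl := lambda' _ Is.
  apply: (is_derive_unique (is_derive_reparam (sstar_smooth 0%N s Is) qphi')).
  apply: (near_eq_is_derive (f := fun x => qpos xi x + lambda x *: qT xi x)).
    apply: filterS (open_nbhs_nbhs (conj oI Is)) => x Ix.
    by case: (inv x Ix).
  apply: is_derive_mx => i j.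
  have xc := is_derive_coord i j qxi'; have Tc := is_derive_coord i j T'.
  have -> : (fun x => (qpos xi x + lambda x *: qT xi x) i j) =
    (fun x => qpos xi x i j) + lambda * (fun x => qT xi x i j).
    by apply/funext => x; rewrite !mxE.
  apply: is_derive_eq; rewrite /GRing.scale /= !mxE; ring.
have lambda'E s : I s -> lambda^`()%classic s = -1.
  move=> Is; have [[TT _ _ _] [[TN _ _] _] _ _] := fr _ Is.
  have [_ Tperp] := inv s Is.
  have := congr1 (fun p => h4 p (qT xi s)) (velocity s Is).
  rewrite h4Zl Tperp mulr0 h4Dl !h4Zl TT (h4C (qN _ _)) TN mulr0 addr0.
  move=> /esym/eqP; rewrite mulf_eq0 (negbTE (is_sign_neq0 sT)) orbF.
  by rewrite addrC addr_eq0 => /eqP.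
(* If lambda vanished on all of I, its derivative would be 0 there instead of -1. *)
have [s [Is ls0]] : exists s, I s /\ lambda s != 0.
  apply: contrapT => /forallNP nl; case: I0 => s Is.
  have l0 x : I x -> lambda x = 0.
    by move=> Ix; apply/eqP/negPn/negP => lx; apply: (nl x).
  have := is_derive_zero_on oI Is l0 (lambda' s Is).
  by rewrite lambda'E// => /eqP; rewrite oppr_eq0 oner_eq0.
have [k0 _ _ _] := nz s Is.
exists s, (lambda s * (epsN xi * qkappa xi s)); split=> //.
  by rewrite !mulf_neq0// is_sign_neq0.
by rewrite velocity// lambda'E// subrr scale0r add0r.
Qed.

(* Differentiating h(T_phi, T_xi) = 0 gives
   s*' eps_N^* kappa^* h(N_phi, T_xi) + eps_N kappa h(T_phi, N_xi) = 0. *)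
Lemma involute_normal (s mu : R) : I s -> mu != 0 ->
  dsstar s *: qT phi (sstar s) = mu *: qN xi s ->
  h4 (qN phi (sstar s)) (qT xi s) != 0.
Proof.
move=> Is mu0 Tphi; have [lambda [_ inv]] := invol.
have [sstar_smooth IJ] := hstar.
have [[[sT sN] fr] _ _ nz] := hxi.
have [[_ frphi] _ _ _] := hphi.
have [_ _ _ [Tphi' _ _ _]] := frphi _ (IJ _ Is).
have [[_ NN _ _] _ _ [T' _ _ _]] := fr _ Is.
have perp x : I x -> h4 (qT phi (sstar x)) (qT xi x) = 0.
  by move=> Ix; case: (inv x Ix).
have := is_derive_zero_on oI Is perp
  (is_derive_h4 (is_derive_reparam (sstar_smooth 0%N s Is) Tphi') T').
rewrite !h4Zl (h4C (qT phi _)) h4Zl => H.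
have [k0 _ _ _] := nz s Is.
(* If h(N_phi, T_xi) = 0, then [H] leaves h(T_phi, N_xi) = 0, and pairing [Tphi] with N_xi gives mu
   eps_N = 0. *)
apply/eqP => NT; move: H; rewrite NT !mulr0 add0r => /eqP.
rewrite !mulf_eq0 (negbTE (is_sign_neq0 sN)) (negbTE k0) /= => /eqP NT0.
have := congr1 (fun p => h4 p (qN xi s)) Tphi.
rewrite !h4Zl (h4C (qT phi _)) NT0 NN mulr0 => /esym/eqP.
by rewrite mulf_eq0 (negbTE mu0) (negbTE (is_sign_neq0 sN)).
Qed.

End Involute.

Theorem theorem3p5 (R : realType) (eps : 'I_3 -> R) (sg : R) (I J : set R)
    (phi xi : quat_curve R) (beta alpha : spatial_curve R) (sstar : R -> R)
    (heps : forall i, is_sign (eps i)) (hsg : is_sign sg)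
    (hI : open_interval I) (hJ : open_interval J)
    (hxi : associated eps sg I xi alpha)
    (hphi : associated eps sg J phi beta)
    (hstar : correspondence I J sstar) :
  involute_evolute I sstar phi xi ->
  ~ spatial_involute_evolute I sstar beta alpha.
Proof.
move=> invol perp; have [oI _ I0] := hI.
have [e0 e1 e2] := associated_signs hxi heps hsg oI I0.
have [s [mu [Is mu0 Tphi]]] := involute_tangent oI I0 hxi hphi hstar invol.
have /eqP := involute_normal oI hxi hphi hstar invol Is mu0 Tphi; apply.
have [[[sT sN] fr] _ NBE _] := hxi.
have [_ _ NBEphi _] := hphi.
have [_ IJ] := hstar.
have [N _ _] := NBE s Is; have [Nphi _ _] := NBEphi _ (IJ s Is).
(* Otherwise mu N_xi = 0, against h(N_xi, N_xi) = eps_N. *)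
have dsstar0 : sstar^`()%classic s != 0.
  apply/eqP => ds0; move: Tphi; rewrite ds0 scale0r => /esym/eqP.
  rewrite scaler_eq0 (negbTE mu0) => /eqP N0.
  have [[_ NN _ _] _ _ _] := fr s Is.
  move/eqP: (is_sign_neq0 sN); apply.
  by rewrite -NN N0 /h4 !mxE; ring.
(* The factor s*' allows T_phi to be replaced by mu N_xi, a multiple of t T_xi, inside N_phi =
   eps_T^phi t^* T_phi. *)
apply: (mulfI dsstar0); rewrite mulr0 Nphi h4Zl mulrCA -h4Zl -qmulZr Tphi.
by rewrite N !qmulZr !h4Zl h4_qmul_qmul// (perp s Is) mul0r !mulr0.
Qed.
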